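(* Let $p>1$ be a real number, let $a,b:\mathbb{Z}\to(0,+\infty)$, and let $f:\mathbb{Z}\times\mathbb{R}\to\mathbb{R}$ be continuous, with $F(k,t)=\int_0^t f(k,s)\,ds$ for $k\in\mathbb{Z}$, $t\in\mathbb{R}$. Assume: (i) there is $b_0$ such that $b(k)\ge b_0>0$ for all $k\in\mathbb{Z}$, and $b(k)\to+\infty$ as $|k|\to+\infty$; (ii) $\lim_{t\to 0}\frac{|f(k,t)|}{|t|^{p-1}}=0$ uniformly for all $k\in\mathbb{Z}$; (iii) there are sequences $\{c_n\},\{d_n\}$ of real numbers such that $0<c_n<d_n<c_{n+1}$ for all $n\in\mathbb{N}$, $\lim_{n\to\infty}c_n=+\infty$, and $f(k,t)\le 0$ for every $k\in\mathbb{Z}$, $n\in\mathbb{N}$ and $t\in[c_n,d_n]$; (iv) for the sequence $\{d_n\}$ in (iii), there is $r<0$ such that $\sum_{k\in\mathbb{Z}}\sup_{t\in[r,d_n]}|F(k,t)|<+\infty$ for all $n\in\mathbb{N}$. Moreover, assume that at least one of the following three conditions is satisfied: (v) $\displaystyle\limsup_{(k,t)\to(+\infty,+\infty)}\frac{F(k,t)}{[a(k+1)+a(k)+b(k)]\,t^p}=+\infty$; (vi) $\displaystyle\limsup_{(k,t)\to(-\infty,+\infty)}\frac{F(k,t)}{[a(k+1)+a(k)+b(k)]\,t^p}=+\infty$; (vii) $\displaystyle\sup_{k\in\mathbb{Z}}\left(\limsup_{t\to+\infty}\frac{F(k,t)}{[a(k+1)+a(k)+b(k)]\,t^p}\right)=+\infty$.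 Then, for any $\lambda>0$, the problem $$\begin{cases}-\Delta\left(a(k)\phi_p(\Delta u(k-1))\right)+b(k)\phi_p(u(k))=\lambda f(k,u(k)) & \text{for all } k\in\mathbb{Z},\\ u(k)\to 0 & \text{as } |k|\to\infty\end{cases}$$ admits a sequence of non-negative solutions in $X$ whose norms $\|\cdot\|$ tend to infinity.
   Context: Here $\phi_p(t)=|t|^{p-2}t$ for $t\in\mathbb{R}$ (with $\phi_p(0)=0$), and $\Delta$ is the forward difference operator, $\Delta u(k-1)=u(k)-u(k-1)$; thus $\Delta(a(k)\phi_p(\Delta u(k-1)))=a(k+1)\phi_p(u(k+1)-u(k))-a(k)\phi_p(u(k)-u(k-1))$. A solution is a function $u:\mathbb{Z}\to\mathbb{R}$; non-negative means $u(k)\ge 0$ for all $k\in\mathbb{Z}$. The space $X$ and its norm are $$X=\Big\{u:\mathbb{Z}\to\mathbb{R}\ :\ \sum_{k\in\mathbb{Z}}\left[a(k)|\Delta u(k-1)|^p+b(k)|u(k)|^p\right]<\infty\Big\},\qquad \|u\|=\Big(\sum_{k\in\mathbb{Z}}\left[a(k)|\Delta u(k-1)|^p+b(k)|u(k)|^p\right]\Big)^{1/p}.$$ The notation $\limsup_{(k,t)\to(\pm\infty,+\infty)}$ means the joint upper limit as $k\to\pm\infty$ in $\mathbb{Z}$ and $t\to+\infty$ in $\mathbb{R}$ simultaneously. *)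

(* Defs.v *)
From HB Require Import structures.
From mathcomp Require Import all_boot all_order all_algebra.
From mathcomp Require Import all_classical all_reals all_analysis.
Set Implicit Arguments.
Unset Strict Implicit.
Unset Printing Implicit Defensive.
Import Order.TTheory GRing.Theory Num.Theory.
Import numFieldNormedType.Exports.
Local Open Scope classical_set_scope.
Local Open Scope ring_scope.

(* The library does not topologize [int]; we give it the discrete topology,
   as the library does for [nat]. *)
HB.instance Definition _ := hasNbhs.Build int principal_filter.
HB.instance Definition _ := Discrete_ofNbhs.Build int erefl.

Definition int_pinfty : set_system int :=
  filter_from [set: int] (fun M => [set k | M <= k]).

Definition int_ninfty : set_system int :=
  filter_from [set: int] (fun M => [set k | k <= M]).

Definition int_infty : set_system int :=
  filter_from [set: int] (fun M => [set k | M <= `|k|]).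

Global Instance int_pinfty_filter : ProperFilter int_pinfty.
Proof.
apply: filter_from_proper; last by move=> M _; exists M => /=.
apply: filter_from_filter; first by exists 0.
move=> M N _ _; exists (Num.max M N) => // k /=.
by rewrite ge_max => /andP[].
Qed.

Global Instance int_ninfty_filter : ProperFilter int_ninfty.
Proof.
apply: filter_from_proper; last by move=> M _; exists M => /=.
apply: filter_from_filter; first by exists 0.
move=> M N _ _; exists (Num.min M N) => // k /=.
by rewrite le_min => /andP[].
Qed.

Global Instance int_infty_filter : ProperFilter int_infty.
Proof.
apply: filter_from_proper; last by move=> M _; exists M; exact: ler_norm.
apply: filter_from_filter; first by exists 0.
move=> M N _ _; exists (Num.max M N) => // k /=.
by rewrite ge_max => /andP[].
Qed.

Section definitions.
Context {R : realType}.

(* At t = 0 the factor [t] gives the value 0, whatever the exponent. *)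
Definition phi (p t : R) : R := `|t| `^ (p - 2) * t.

Definition fdiff (u : int -> R) (k : int) : R := u (k + 1) - u k.

(* Since [F] is also evaluated at negative arguments, the integral from [x]
   to [y] is oriented. *)
Definition oriented_integral (g : R -> R) (x y : R) : R :=
  if x <= y then \int[lebesgue_measure]_(s in `[x, y]) g s
  else - \int[lebesgue_measure]_(s in `[y, x]) g s.

Definition primitive (f : int * R -> R) (k : int) (t : R) : R :=
  oriented_integral (fun s => f (k, s)) 0 t.

Definition energy (p : R) (a b u : int -> R) : \bar R :=
  \esum_(k in [set: int])
     (a k * `|fdiff u (k - 1)| `^ p + b k * `|u k| `^ p)%:E.

Definition spaceX (p : R) (a b : int -> R) : set (int -> R) :=
  [set u | (energy p a b u < +oo)%E].

Definition normX (p : R) (a b u : int -> R) : R :=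
  fine (energy p a b u) `^ p^-1.

Definition growth_ratio (p : R) (a b : int -> R) (f : int * R -> R)
    (k : int) (t : R) : R :=
  primitive f k t / ((a (k + 1) + a k + b k) * t `^ p).

Definition is_solution (p lambda : R) (a b : int -> R) (f : int * R -> R)
    (u : int -> R) : Prop :=
  (forall k : int,
     - fdiff (fun j => a j * phi p (fdiff u (j - 1))) k + b k * phi p (u k)
     = lambda * f (k, u k)) /\
  u k @[k --> int_infty] --> (0 : R).

End definitions.

(* Main.v *)
(* Write [mu = p * lambda] and [A k = a (k + 1) + a k + b k]. Up to an additive
   constant, [p] times the energy functional of the problem is a sum over [k]
   of nonnegative continuous functions of finitely many coordinates on the box
   of sequences with values in [0, d n]; it is therefore lower semicontinuous
   for the product topology and attains its minimum on this compact box.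

   A minimizer [u] is critical in each coordinate [k]. This is clear if
   [0 < u k < d n]. If [u k = d n], then [f (k, d n) <= 0] makes the left
   derivative in that coordinate positive, which is absurd. If [u k = 0], then
   [f (k, 0) = 0] and the right derivative, which is nonnegative, is minus a sum
   of two nonnegative terms, so it vanishes.

   The growth condition gives, for any [S], a spike [t] at a single site [k] with
   [mu F(k, t) - A k * t ^ p > S]. Taking for [S] the sum over [k] of [mu] times
   the supremum of [|F(k, .)|] on [[r, d m]], the minimizer on any larger box
   containing the spike cannot be bounded by [d m], hence has a large norm. *)

Require Import Defs.
From HB Require Import structures.
From mathcomp Require Import all_boot all_order all_algebra.
From mathcomp Require Import all_classical all_reals all_analysis.
From mathcomp Require Import zify ring lra.
Import Order.TTheory GRing.Theory Num.Theory.
Import numFieldNormedType.Exports.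
Local Open Scope classical_set_scope.
Local Open Scope ring_scope.

(** * One-sided minima, the derivative of [|t| ^ p], and antiderivatives *)

Section RealFunctions.
Context {R : realType}.
Implicit Types (g : R -> R) (p x y t D : R).

(** Right difference quotients are nonnegative. The minimum is one-sided because a minimizer may sit
    at an end of its segment. *)
Lemma is_derive_min_right g x z D :
  is_derive x 1 g D -> x < z -> (forall y, x <= y <= z -> g x <= g y) -> 0 <= D.
Proof.
move=> [dg gD] xz gmin.
have cD : (h^-1 *: ((g \o shift x) (h *: 1) - g x)) @[h --> 0^'+] --> D.
  by apply: cvg_dnbhs_at_right; rewrite -gD; exact: dg.
have <- := cvg_lim (@Rhausdorff _) cD.
apply: limr_ge; first by apply/cvg_ex; exists D.
near=> h.
have h0 : 0 < h by near: h; exact: nbhs_right_gt.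
have hz : h < z - x by near: h; apply: nbhs_right_lt; rewrite subr_gt0.
apply: mulr_ge0; first by rewrite invr_ge0 ltW.
rewrite subr_ge0 /= [_%:A]mulr1; apply: gmin; lra.
Unshelve. all: end_near. Qed.

Lemma is_derive_min_left g x z D :
  is_derive x 1 g D -> z < x -> (forall y, z <= y <= x -> g x <= g y) -> D <= 0.
Proof.
move=> dg zx gmin; rewrite -oppr_ge0.
have dN : is_derive (- x) 1 (g \o -%R) (- D).
  have -> : - D = D * -1 by rewrite mulrN1.
  apply: is_derive1_comp; first by rewrite opprK.
apply: (is_derive_min_right _ _ (- z) _ dN) => [|y yx]; first by rewrite ltrN2.
by rewrite /= opprK; apply: gmin; lra.
Qed.

Lemma phi_gt0 p x : 0 < x -> 0 < phi p x.
Proof. by move=> x0; rewrite mulr_gt0 // powR_gt0 // normr_gt0 gt_eqF. Qed.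

Lemma phi0 p : phi p 0 = 0 :> R.
Proof. by rewrite /phi mulr0. Qed.

Lemma phiN p x : phi p (- x) = - phi p x.
Proof. by rewrite /phi normrN mulrN. Qed.

Lemma phi_ge0 p x : 0 <= x -> 0 <= phi p x.
Proof. by move=> x0; rewrite mulr_ge0 // powR_ge0. Qed.

Lemma phi_powR p x : 0 < x -> phi p x = x `^ (p - 1).
Proof.
move=> x0; rewrite /phi gtr0_norm // -[X in _ * X]powRr1 ?ltW//.
by rewrite -powRD ?(gt_eqF x0) ?implybT //; congr (_ `^ _); ring.
Qed.

Lemma cvg_normr_powR0 (q : R) : 0 < q -> `|x| `^ q @[x --> (0 : R)^'] --> (0 : R).
Proof.
move=> q0; have r : `|x| `^ q @[x --> (0 : R)^'+] --> (0 : R).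
  apply: cvg_trans (powR_cvg0 q0); apply: near_eq_cvg; near=> x.
  by rewrite gtr0_norm //; near: x; exact: nbhs_right_gt.
apply: (@cvg_at_right_left_dnbhs R R^o (fun x => `|x| `^ q) 0 0); first exact: r.
apply/cvg_at_leftNP; rewrite oppr0.
have -> : (fun x : R => `|x| `^ q) \o -%R = (fun x => `|x| `^ q).
  by apply/funext => x /=; rewrite normrN.
exact: r.
Unshelve. all: end_near. Qed.

(** Away from 0 this is the derivative of [powR], reflected for negative [x]. At 0 the difference
    quotient has absolute value [|h| ^ (p - 1)], which tends to 0 because [1 < p]. *)
Lemma is_derive_normr_powR p x : 1 < p ->
  is_derive x 1 (fun t => `|t| `^ p) (p * phi p x).
Proof.
move=> p1.
have pos y : 0 < y -> is_derive y 1 (fun t => `|t| `^ p) (p * phi p y).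
  move=> y0; apply: (@near_eq_is_derive _ R R (fun t => t `^ p)).
  - by near=> t; rewrite gtr0_norm //; near: t; exact: lt_nbhsr.
  - by rewrite phi_powR //; exact: is_derive1_powR.
have [x0|x0|->] := ltgtP x 0.
- have -> : p * phi p x = p * phi p (- x) * -1 by rewrite phiN; ring.
  have -> : (fun t => `|t| `^ p) = (fun t => `|t| `^ p) \o -%R.
    by apply/funext => t /=; rewrite normrN.
  apply: is_derive1_comp.
  by apply: pos; rewrite oppr_gt0.
- exact: pos.
- have p10 : 0 < p - 1 by rewrite subr_gt0.
  have p0 : 0 < p by exact: lt_trans p1.
  have cv : h^-1 *: (((fun t : R => `|t| `^ p) \o shift 0) (h *: (1 : R))
      - `|0 : R| `^ p) @[h --> (0 : R)^'] --> (0 : R).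
    have /cvgrPdist_lt pow0 := cvg_normr_powR0 _ p10.
    apply/cvgrPdist_lt => e e0; near=> h.
    have h0 : h != 0 by near: h; exact: nbhs_dnbhs_neq.
    have he : `|0 - `|h| `^ (p - 1)| < e by near: h; exact: pow0.
    rewrite /= addr0 [_%:A]mulr1 normr0 powR0 ?gt_eqF // subr0.
    apply: le_lt_trans he; rewrite !sub0r !normrN normrM normfV.
    rewrite !(@ger0_norm _ (_ `^ _)) ?powR_ge0 //.
    by rewrite -(@mulr_powRB1 _ `|h| p) // mulrA mulVf ?mul1r // normr_eq0.
  rewrite phi0 mulr0; split; first by apply/cvg_ex; exists 0.
  exact: cvg_lim cv.
Unshelve. all: end_near. Qed.

(** Integration starts at -1, so that [0, D] is interior to [-1, D + 1] and the derivative is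
    two-sided even at 0 and [D]. *)
Lemma antiderivative (h : R -> R) D : continuous h -> exists H : R -> R,
  (forall x, 0 <= x <= D -> is_derive x 1 H (h x)) /\
  (forall t, 0 <= t <= D ->
     \int[lebesgue_measure]_(s in `[0, t]) h s = H t - H 0).
Proof.
move=> ch.
have ci u v : lebesgue_measure.-integrable `[u, v] (EFin \o h).
  apply: continuous_compact_integrable; first exact: segment_compact.
  exact: continuous_subspaceT.
exists (fun t => \int[lebesgue_measure]_(s in `[-1, t]) h s); split.
  move=> x /andP[x0 xD].
  have [] := @continuous_FTC1_closed _ h (-1) x (D + 1) _ (ci _ _) _ (ch x).
  - lra.
  - lra.
  - by move=> dH; rewrite derive1E => <-; split.
move=> t /andP[t0 tD].
have E := @Rintegral_itvB _ h (BLeft (-1)) (BRight t) 0 (ci _ _).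
rewrite E ?bnd_simp ?lerN10 // Rintegral_itv_obnd_cbnd //.
apply: integrableS (ci 0 t) => //.
by apply: subset_itvr; rewrite bnd_simp.
Qed.

End RealFunctions.

(** * Sums of nonnegative terms and their minimization over a compact set *)

Section Esum.
Context {R : realType} {I : choiceType}.

Lemma esum_split2 (w : I -> \bar R) (k l : I) :
  (forall i, 0 <= w i)%E -> k != l ->
  (\esum_(i in [set: I]) w i =
   w k + w l + \esum_(i in ~` [set k; l]) w i)%E.
Proof.
move=> w0 kl; rewrite (esumID [set k; l]) // !setTI; congr (_ + _)%E.
rewrite esum_fset; [|exact: finite_set2|by []].
rewrite fsbigU0 ?fsbig_set1 //.
by move=> i [/= -> /eqP]; rewrite (negbTE kl).
Qed.

Lemma term_le_esum (w : I -> \bar R) (k : I) :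
  (forall i, 0 <= w i)%E -> (w k <= \esum_(i in [set: I]) w i)%E.
Proof.
by move=> w0; apply: esum_ge; exists [set k]; rewrite ?fsbig_set1.
Qed.

Lemma esum_scale_lty (t : R) (w : I -> \bar R) : 0 <= t ->
  (forall i, 0 <= w i)%E -> (\esum_(i in [set: I]) w i < +oo)%E ->
  (\esum_(i in [set: I]) (t%:E * w i) < +oo)%E.
Proof.
move=> t0 w0 wf; apply: (@le_lt_trans _ _ (t%:E * \esum_(i in [set: I]) w i)%E).
  apply: ge_ereal_sup => _ [X [finX _] <-]; rewrite -ge0_mule_fsumr //.
  by apply: lee_wpmul2l; rewrite ?lee_fin //; apply: esum_ge; exists X.
rewrite -(fineK (x := esum _ _)) ?ltry //.
by rewrite ge0_fin_numE // esum_ge0.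
Qed.

(** Direct method: the sets [B e], where the sum is below its infimum plus [e], generate a filter,
    which by compactness has a cluster point [x] in [K]. If a finite partial sum at [x] exceeded the
    infimum by more than [e], then by continuity it would do so near [x], hence at a point of
    [B e]. *)
Lemma exists_esum_min {T : topologicalType} (K : set T) (G : I -> T -> R) :
  compact K -> K !=set0 -> (forall i x, K x -> {for x, continuous (G i)}) ->
  (forall i x, K x -> 0 <= G i x) ->
  exists2 x, K x & forall y, K y ->
    (\esum_(i in [set: I]) (G i x)%:E <= \esum_(i in [set: I]) (G i y)%:E)%E.
Proof.
move=> cK [x0 Kx0] cG G0.
pose E x : \bar R := (\esum_(i in [set: I]) (G i x)%:E)%E.
pose l := ereal_inf (E @` K).
have lE y : K y -> (l <= E y)%E by move=> Ky; apply: ereal_inf_lbound; exists y.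
have l0 : (0 <= l)%E.
  by apply: le_ereal_inf_tmp => _ [y Ky <-]; apply: esum_ge0 => i _; rewrite lee_fin G0.
(* If the infimum is [+oo], every point of [K] is a minimizer. *)
have [loo|lfin] := eqVneq l +oo%E.
  by exists x0 => // y Ky; rewrite -/(E y) (_ : E y = +oo%E) ?leey //;
    apply/eqP; rewrite -leye_eq -loo lE.
have {}lfin : l \is a fin_num by rewrite ge0_fin_numE // ltey.
pose B (e : R) := [set x | K x /\ (E x < l + e%:E)%E].
pose F := filter_from [set e : R | 0 < e] B.
have FF : ProperFilter F.
  apply: filter_from_proper.
    apply: filter_from_filter; first by exists 1 => /=.
    move=> e1 e2 /= e10 e20; exists (Num.min e1 e2); first by rewrite /= lt_min e10.
    move=> x [Kx]; rewrite EFin_min => xl.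
    by split; split => //; apply: lt_le_trans xl _; rewrite leeD2l // ge_min lexx ?orbT.
  move=> e /= e0; have : (l < l + e%:E)%E by rewrite lteDl.
  by move=> /ereal_inf_lt[_ [x Kx <-] xl]; exists x.
have [x [Kx clx]] : K `&` cluster F !=set0.
  by apply: cK; exists 1 => //= y [].
exists x => // y Ky; apply: le_trans (lE y Ky).
apply: ge_ereal_sup => _ [X [finX _] <-]; rewrite fsumEFin // fsbig_finite //.
pose S z := \sum_(i <- finmap.enum_fset (fset_set X)) G i z.
rewrite -[leLHS]/(S x)%:E; apply/lee_addgt0Pr => e e0; rewrite leNgt; apply/negP => lS.
have cS : {for x, continuous S} by apply: cvg_big => // [|i _]; [exact: add_continuous|exact: cG].
have nS : nbhs x [set z | fine l + e < S z].
  have lS' : fine l + e < S x by rewrite -lte_fin EFinD fineK.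
  exact: cS _ (lt_nbhsr lS').
have FB : F (B e) by exists e.
have [z [[Kz Ez] /= Sz]] := clx _ _ FB nS.
move: Ez; rewrite ltNge => /negP; apply.
apply: (@le_trans _ _ (S z)%:E); first by rewrite -(fineK lfin) -EFinD lee_fin ltW.
by apply: esum_ge; exists X => //; rewrite fsumEFin // fsbig_finite.
Qed.

End Esum.

(** * The action functional on a box and its minimizers *)

Section Variational.
Context {R : realType}.
(** In the application [D] is some [d n] and [h] is [p * lambda * f], whose factor [p] matches the
    one that comes from differentiating [|t| ^ p]. *)
Variables (p D b0 : R) (a b s : int -> R) (h H : int -> R -> R).
Hypotheses (p1 : 1 < p) (D0 : 0 < D) (b00 : 0 < b0).
Hypotheses (a0 : forall k, 0 < a k) (bb0 : forall k, b0 <= b k).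
Hypothesis dH : forall k x, 0 <= x <= D -> is_derive x 1 (H k) (h k x).
Hypothesis H0 : forall k, H k 0 = 0.
Hypothesis Hs : forall k x, 0 <= x <= D -> H k x <= s k.
Hypothesis h0 : forall k, h k 0 = 0.
Hypothesis hD : forall k, h k D <= 0.

Definition box : set (int -> R) := [set u | forall k, 0 <= u k <= D].

(* Adding [s k] makes every term nonnegative on the box, and shifts the energy
   functional by a constant. *)
Definition density (u : int -> R) (k : int) : R :=
  a k * `|fdiff u (k - 1)| `^ p + b k * `|u k| `^ p + (s k - H k (u k)).

Definition action (u : int -> R) : \bar R :=
  (\esum_(k in [set: int]) (density u k)%:E)%E.

Let b_gt0 k : 0 < b k. Proof. exact: lt_le_trans (bb0 k). Qed.

Lemma elastic_ge0 u k : 0 <= a k * `|fdiff u (k - 1)| `^ p + b k * `|u k| `^ p.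
Proof. by apply: addr_ge0; apply: mulr_ge0; rewrite ?powR_ge0 // ltW. Qed.

Lemma density_ge_elastic u k : box u ->
  a k * `|fdiff u (k - 1)| `^ p + b k * `|u k| `^ p <= density u k.
Proof. by move=> bu; rewrite lerDl subr_ge0; exact/Hs/bu. Qed.

Lemma density_ge0 u k : box u -> 0 <= density u k.
Proof. by move=> bu; apply: le_trans (elastic_ge0 _ _) (density_ge_elastic u k bu). Qed.

Lemma density_eq u v k : u k = v k -> u (k - 1) = v (k - 1) ->
  density u k = density v k.
Proof. by rewrite /density /fdiff subrK => -> ->. Qed.

Lemma box0 : box (fun=> 0).
Proof. by move=> k; rewrite lexx ltW. Qed.

Lemma density0 k : density (fun=> 0) k = s k.
Proof.
have p0 : p != 0 by rewrite gt_eqF // (lt_trans _ p1).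
by rewrite /density /fdiff subrr normr0 powR0 // H0 !mulr0 !add0r subr0.
Qed.

Lemma action0 : action (fun=> 0) = (\esum_(k in [set: int]) (s k)%:E)%E.
Proof. by apply: eq_esum => k _; rewrite density0. Qed.

Lemma exists_action_min :
  exists2 u, box u & forall v, box v -> (action u <= action v)%E.
Proof.
(* In the topology of pointwise convergence the box is compact by Tychonoff's theorem; in the sup
   norm it would not be. *)
pose T : topologicalType := prod_topology (fun _ : int => (R : topologicalType)).
have cB : compact (box : set T).
  have -> : box = [set u : T | forall k, `[0, D]%classic (u k)].
    apply/seteqP; split => u /= bu k; first by rewrite in_itv /=; exact: bu.
    by have := bu k; rewrite /= in_itv.
  exact: (tychonoff (fun=> @segment_compact R 0 D)).
apply: (@exists_esum_min R int T box (fun k u => density u k)) => //.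
- by exists (fun=> 0); exact: box0.
- move=> k u bu.
  have cproj j : {for u, continuous (fun v : T => v j : R)}.
    by exact: (@proj_continuous int (fun=> R) j u).
  have cpow (t : R) : {for t, continuous (fun t : R => `|t| `^ p)}.
    apply: differentiable_continuous; apply/derivable1_diffP.
    by have [] := is_derive_normr_powR p t p1.
  have cdiff : {for u, continuous (fun v : T => v (k - 1 + 1) - v (k - 1) : R)}.
    exact: (@continuousB _ R T _ _ u (cproj _) (cproj _)).
  have c1 : {for u, continuous (fun v : T => `|v (k - 1 + 1) - v (k - 1)| `^ p : R)}.
    exact: (@continuous_comp T R R _ _ u cdiff (cpow _)).
  have c2 : {for u, continuous (fun v : T => `|v k| `^ p : R)}.
    exact: (@continuous_comp T R R _ _ u (cproj k) (cpow _)).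
  have c3 : {for u, continuous (fun v : T => H k (v k) : R)}.
    apply: (@continuous_comp T R R _ (H k) u (cproj k)).
    apply: differentiable_continuous; apply/derivable1_diffP.
    by have [] := dH k (u k) (bu k).
  have cc (z : R) : {for u, continuous (fun _ : T => z)} by exact: cst_continuous.
  have c12 := @continuousD _ R T _ _ u (@continuousM R T _ _ u (cc (a k)) c1)
    (@continuousM R T _ _ u (cc (b k)) c2).
  have c3s := @continuousB _ R T _ _ u (cc (s k)) c3.
  exact: (@continuousD _ R T _ _ u c12 c3s).
- by move=> k u bu; exact: density_ge0.
Qed.

(** Coordinate [k] enters only the terms [k] and [k + 1], through the differences on either side of
    it. *)
Lemma esum_density_split u k : box u ->
  action u = ((density u k + density u (k + 1))%:E +
    \esum_(j in ~` [set k; (k + 1)%R]) (density u j)%:E)%E.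
Proof.
move=> bu; rewrite /action (esum_split2 _ k (k + 1)) //.
- by move=> j; rewrite lee_fin density_ge0.
- lia.
Qed.

(** The remaining terms agree for [u] and [v], and their sum is finite because [action u] is, so it
    can be cancelled. *)
Lemma esum_density_local u v k : box u -> box v -> (action u < +oo)%E ->
  (action u <= action v)%E -> (forall j, j != k -> u j = v j) ->
  density u k + density u (k + 1) <= density v k + density v (k + 1).
Proof.
move=> bu bv ufin uv E; move: ufin uv.
rewrite !(esum_density_split _ k) //.
have -> : (\esum_(j in ~` [set k; (k + 1)%R]) (density u j)%:E)%E =
          (\esum_(j in ~` [set k; (k + 1)%R]) (density v j)%:E)%E.
  apply: eq_esum => j /= jk; congr _%:E; apply: density_eq; apply: E.
    by apply/eqP => ?; apply: jk; left.
  by apply/eqP => jk'; apply: jk; right; lia.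
set r := esum _ _ => rfin uv; rewrite -lee_fin -(@leeD2rE _ r) //.
have r0 : (0 <= r)%E by apply: esum_ge0 => j _; rewrite lee_fin density_ge0.
rewrite ge0_fin_numE //; apply: le_lt_trans rfin; rewrite leeDr // lee_fin.
by rewrite addr_ge0 ?density_ge0.
Qed.

Definition spike (k : int) (t : R) : int -> R := fun j => if j == k then t else 0.

(** Compared with the zero sequence, the spike costs [t ^ p] with weights [a k] and [a (k + 1)] for
    its two jumps and [b k] for its height, and gains [H k t]. Adding a finite quantity avoids
    subtracting infinite sums. *)
Lemma action_spike k t : 0 <= t <= D ->
  (action (spike k t) + (H k t - (a (k + 1) + a k + b k) * t `^ p)%:E =
  \esum_(k in [set: int]) (s k)%:E)%E.
Proof.
move=> /andP[t0 tD].
have bs : box (spike k t) by move=> j; rewrite /spike; case: ifP; lra.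
have p0 : p != 0 by rewrite gt_eqF // (lt_trans _ p1).
rewrite -action0 !(esum_density_split _ k) ?density0; [|exact: box0|by []].
rewrite addeAC -EFinD; congr (_%:E + _)%E; last first.
  apply: eq_esum => j /= jk; congr _%:E; apply: density_eq; rewrite /spike ifF //.
    by apply/eqP => ?; apply: jk; left.
  by apply/eqP => jk'; apply: jk; right; lia.
have k1 : (k - 1 == k) = false by lia.
have k1' : (k + 1 == k) = false by lia.
rewrite /density /fdiff /spike !addrK ?subrK k1 k1' eqxx sub0r subr0 normrN normr0.
rewrite powR0 // H0 ger0_norm //; ring.
Qed.

(** Varying coordinate [k] alone gives a function [g] of one variable that is minimal at [u k] on
    [0, D]; its derivative there is shown to vanish. *)
Lemma action_min_critical u k : box u -> (action u < +oo)%E ->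
  (forall v, box v -> (action u <= action v)%E) ->
  p * (a k * phi p (u k - u (k - 1)) - a (k + 1) * phi p (u (k + 1) - u k)
       + b k * phi p (u k)) = h k (u k).
Proof.
move=> bu ufin umin.
pose v t : int -> R := fun j => if j == k then t else u j.
pose l := u (k - 1); pose r := u (k + 1); pose x := u k.
(* The difference to the right neighbour is written [t - r] instead of [r - t], so that [dpow]
   differentiates both differences. *)
pose g t := a k * `|t - l| `^ p + b k * `|t| `^ p + (s k - H k t)
  + (a (k + 1) * `|t - r| `^ p + (b (k + 1) * `|r| `^ p + (s (k + 1) - H (k + 1) r))).
have gE t : density (v t) k + density (v t) (k + 1) = g t.
  have k1 : (k - 1 == k) = false by lia.
  have k1' : (k + 1 == k) = false by lia.
  rewrite /density /fdiff /v !addrK ?subrK k1 k1' eqxx /g (distrC t r); ring.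
have vx : v x = u by apply/funext => j; rewrite /v; case: eqP => [->|].
have gmin t : 0 <= t <= D -> g x <= g t.
  move=> tD; rewrite -!gE vx; apply: esum_density_local => //.
  - by move=> j; rewrite /v; case: ifP.
  - by apply: umin => j; rewrite /v; case: ifP.
  - by move=> j jk; rewrite /v ifN.
have dpow y : is_derive x 1 (fun t => `|t - y| `^ p) (p * phi p (x - y)).
  have -> : (fun t => `|t - y| `^ p) = (fun t => `|t| `^ p) \o (fun t => t - y) by [].
  have -> : p * phi p (x - y) = p * phi p (x - y) * (1 - 0) by rewrite subr0 mulr1.
  by apply: is_derive1_comp; exact: is_derive_normr_powR.
have dpow0 := is_derive_normr_powR p x p1.
have dHx := dH k x (bu k).
have dg : is_derive x 1 g (p * (a k * phi p (x - l) + b k * phi p x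
    + a (k + 1) * phi p (x - r)) - h k x).
  rewrite /g; apply: is_derive_eq.
  rewrite ?scaler0 /GRing.scale /=; ring.
have -> : phi p (u (k + 1) - u k) = - phi p (x - r) by rewrite -phiN opprB.
have xD := bu k; rewrite -/x in xD.
suff : p * (a k * phi p (x - l) + b k * phi p x + a (k + 1) * phi p (x - r)) - h k x = 0.
  by rewrite -/l -/x => e; rewrite mulrN opprK; lra.
have p0 : 0 < p by exact: lt_trans p1.
(* At 0 both neighbours are at least 0, which gives the slope the sign opposite to that of the
   one-sided minimum. *)
have [x0|x0] := eqVneq x 0.
- have : 0 <= p * (a k * phi p (x - l) + b k * phi p x + a (k + 1) * phi p (x - r)) - h k x.
    apply: (is_derive_min_right g x D _ dg) => [|y]; first by rewrite x0.
    case/andP => xy yD; apply: gmin; rewrite yD andbT.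
    by case/andP: xD => [x_ge0 _]; exact: le_trans xy.
  rewrite x0 h0 phi0 mulr0 addr0 subr0 !sub0r !phiN.
  have A0 : 0 <= a k * phi p l + a (k + 1) * phi p r.
    have l0 : 0 <= l by case/andP: (bu (k - 1)).
    have r0 : 0 <= r by case/andP: (bu (k + 1)).
    by rewrite addr_ge0 // mulr_ge0 ?phi_ge0 // ltW.
  rewrite -[leRHS]opprK oppr_ge0 -mulrN pmulr_rle0 // => A1; apply/eqP.
  rewrite mulf_eq0; apply/orP; right; apply/eqP; lra.
have {}x0 : 0 < x by rewrite lt_neqAle eq_sym x0; case/andP: xD.
have dle : p * (a k * phi p (x - l) + b k * phi p x + a (k + 1) * phi p (x - r)) - h k x <= 0.
  apply: (is_derive_min_left g x 0 _ dg) => // y yx; apply: gmin.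
  by case/andP: yx => -> yx; rewrite (le_trans yx) //; case/andP: xD.
(* At [D] both neighbours are at most [D], and [b k * phi p D] makes the slope strictly positive,
   against [dle]. *)
have [xD'|xD'] := eqVneq x D.
  exfalso; move: dle; apply/negP; rewrite -ltNge xD'.
  rewrite subr_gt0; apply: (le_lt_trans (hD k)); apply: mulr_gt0 => //.
  have uD j : 0 <= D - u j by rewrite subr_ge0; case/andP: (bu j).
  have uDl : 0 <= D - l := uD _.
  have uDr : 0 <= D - r := uD _.
  apply: ltr_wpDr; first by rewrite mulr_ge0 ?phi_ge0 // ltW.
  apply: ltr_wpDl; first by rewrite mulr_ge0 ?phi_ge0 // ltW.
  by rewrite mulr_gt0 ?phi_gt0.
apply/eqP; rewrite eq_le dle /=.
apply: (is_derive_min_right g x D _ dg).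
  by rewrite lt_neqAle xD'; case/andP: xD.
move=> y /andP[xy yD]; apply: gmin; rewrite yD andbT; exact: le_trans (ltW x0) xy.
Qed.

(** A finite set [X] carries all of the action but [eta]. Outside it each term is below
    [eta = b0 * e ^ p], while a term with [e <= |u k|] is at least [eta]. *)
Lemma action_cvg0 u : box u -> (action u < +oo)%E -> u k @[k --> int_infty] --> (0 : R).
Proof.
move=> bu ufin; have p0 : 0 < p by exact: lt_trans p1.
apply/cvgrPdist_lt => e e0; pose eta := b0 * e `^ p.
have eta0 : 0 < eta by rewrite mulr_gt0 // powR_gt0.
have du j : (0 <= (density u j)%:E)%E by rewrite lee_fin density_ge0.
have Afin : action u \is a fin_num by rewrite ge0_fin_numE // esum_ge0.
have : (action u - eta%:E < action u)%E by rewrite lteBlDr // lteDl.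
move=> /ereal_sup_gt[_ [X [finX _] <-] uX].
(* This exceeds [|j|] for every [j] in [X]. *)
pose M := \sum_(j <- finmap.enum_fset (fset_set X)) `|j| + 1.
exists M => // k /= Mk.
have kX : ~ X k.
  move=> Xk; move: Mk; apply/negP; rewrite -ltNge ltzD1.
  rewrite (bigD1_seq k) /= ?finmap.fset_uniq //; last by rewrite in_fset_set // mem_set.
  by rewrite lerDl sumr_ge0.
have dk : density u k < eta.
  have : ((density u k)%:E + \sum_(j \in X) (density u j)%:E <= action u)%E.
    apply: esum_ge; exists ([set k] `|` X); first by split; rewrite // finite_setU.
    by rewrite fsbigU0 ?fsbig_set1 // => j [/= -> ].
  move: uX; rewrite fsumEFin // -(fineK Afin) -EFinB -EFinD lte_fin lee_fin; lra.
rewrite sub0r normrN; apply: contraTT dk; rewrite -!leNgt => eu.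
have := density_ge_elastic u k bu; apply: le_trans.
apply: (@le_trans _ _ (b k * `|u k| `^ p)); last first.
  by rewrite lerDr mulr_ge0 ?powR_ge0 // ltW.
apply: ler_pM => //; [exact: ltW|exact: powR_ge0|].
by apply: ge0_ler_powR => //; rewrite ?nnegrE ltW.
Qed.

Hypothesis s_summable : (\esum_(k in [set: int]) (s k)%:E < +oo)%E.

(** If [H j (u j) <= s' j] for all [j], then the action of [u] is at least the sum of [s] minus that
    of [s']. The spike, whose gain exceeds the sum of [s'], has a smaller action, against
    minimality. *)
Lemma action_min_large u k t : box u -> (forall v, box v -> (action u <= action v)%E) ->
  0 <= t <= D -> forall s' : int -> R,
  (forall j, 0 <= s' j) ->
  (\esum_(j in [set: int]) (s' j)%:E < (H k t - (a (k + 1) + a k + b k) * t `^ p)%:E)%E ->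
  exists j, s' j < H j (u j).
Proof.
move=> bu umin tD s' s'0 s't; apply: contrapT => /forallNP noj.
have le_s' : (\esum_(j in [set: int]) (s j)%:E <=
    action u + \esum_(j in [set: int]) (s' j)%:E)%E.
  rewrite -esumD => [|j _|j _]; [|by rewrite lee_fin density_ge0|by rewrite lee_fin].
  apply: le_esum => j _; rewrite -EFinD lee_fin /density.
  have := elastic_ge0 u j; have /negP := noj j; rewrite -leNgt; lra.
have bs : box (spike k t) by move=> j; rewrite /spike; case: ifP; lra.
move: s_summable; rewrite -(action_spike k t tD) => sfin.
have afin : action (spike k t) \is a fin_num.
  rewrite ge0_fin_numE; last by apply: esum_ge0 => j _; rewrite lee_fin density_ge0.
  by move: sfin; case: (action _) => [z||] /=; rewrite ?ltry ?ltNyr.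
move: le_s'; rewrite -(action_spike k t tD); apply/negP; rewrite -ltNge.
apply: (@le_lt_trans _ _ (action (spike k t) + \esum_(j in [set: int]) (s' j)%:E)%E).
  by rewrite leeD2r // umin.
by rewrite lteD2lE.
Qed.

End Variational.

(** * Points extracted from an upper limit, and a bound of the norm by one coordinate *)

Lemma lt_limf_esup {R : realType} {T : choiceType} {X : filteredType T} (g : X -> \bar R)
    (F : set_system X) (V : set X) (M : \bar R) :
  (M < limf_esup g F)%E -> F V -> exists2 x, V x & (M < g x)%E.
Proof.
move=> Mg FV; have /ereal_sup_gt[_ [x Vx <-] Mx] : (M < ereal_sup (g @` V))%E.
  by apply: lt_le_trans Mg _; apply: ereal_inf_lbound; exists V.
by exists x.
Qed.

(** The single summand [b k * |u k| ^ p] already bounds the energy below by [b0 * B ^ p]. *)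
Lemma normX_ge {R : realType} (p b0 B : R) (a b u : int -> R) (k : int) :
  1 < p -> 0 < b0 -> (forall j, 0 < a j) -> (forall j, b0 <= b j) ->
  0 <= B <= `|u k| -> spaceX p a b u -> b0 `^ p^-1 * B <= normX p a b u.
Proof.
move=> p1 b00 a0 bb0 /andP[B0 Bu] uX; have p0 : 0 < p by exact: lt_trans p1.
have E0 j := elastic_ge0 p b0 a b b00 a0 bb0 u j.
have Efin : energy p a b u \is a fin_num.
  by rewrite ge0_fin_numE // esum_ge0 // => j _; rewrite lee_fin.
have bE : b0 * B `^ p <= fine (energy p a b u).
  rewrite -lee_fin fineK //; apply: le_trans (term_le_esum _ k _); last first.
    by move=> j; rewrite lee_fin.
  rewrite lee_fin; apply: (@le_trans _ _ (b k * `|u k| `^ p)).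
    apply: ler_pM => //; [exact: ltW|exact: powR_ge0|].
    by apply: ge0_ler_powR => //; rewrite ltW.
  by rewrite lerDr mulr_ge0 ?powR_ge0 // ltW.
have -> : b0 `^ p^-1 * B = (b0 * B `^ p) `^ p^-1.
  by rewrite powRM ?powR_ge0 ?ltW // -powRrM mulfV ?gt_eqF // powRr1.
have bB0 : 0 <= b0 * B `^ p by rewrite mulr_ge0 ?powR_ge0 // ltW.
apply: ge0_ler_powR; rewrite ?nnegrE ?invr_ge0 //; first exact: ltW.
exact: le_trans bE.
Qed.

(** * Construction of solutions of arbitrarily large norm *)

Theorem theorem1 (R : realType) (p : R) (a b : int -> R) (f : int * R -> R)
    (c d : nat -> R)
    (hp : 1 < p)
    (ha : forall k : int, 0 < a k)
    (hb : forall k : int, 0 < b k)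
    (hf : continuous f)
    (hi : (exists2 b0 : R, 0 < b0 & forall k : int, b0 <= b k) /\
          b k @[k --> int_infty] --> +oo)
    (hii : forall e : R, 0 < e ->
       \forall t \near (0 : R)^',
         forall k : int, `| `|f (k, t)| / `|t| `^ (p - 1) - 0 | < e)
    (hiii : [/\ forall n : nat, [/\ 0 < c n, c n < d n & d n < c n.+1],
                c n @[n --> \oo] --> +oo &
                forall (k : int) (n : nat) (t : R),
                  c n <= t <= d n -> f (k, t) <= 0])
    (hiv : exists2 r : R, r < 0 & forall n : nat,
       (\esum_(k in [set: int])
          ereal_sup [set `|primitive f k t|%:E | t in `[r, d n]] < +oo)%E)
    (hv_vi_vii :
       [\/ limf_esup (fun x : int * R => (growth_ratio p a b f x.1 x.2)%:E)
             (filter_prod int_pinfty (pinfty_nbhs R)) = +oo%E,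
           limf_esup (fun x : int * R => (growth_ratio p a b f x.1 x.2)%:E)
             (filter_prod int_ninfty (pinfty_nbhs R)) = +oo%E |
           ereal_sup [set limf_esup (fun t : R => (growth_ratio p a b f k t)%:E)
                            (pinfty_nbhs R) | k in [set: int]] = +oo%E]) :
  forall lambda : R, 0 < lambda ->
    exists u : nat -> int -> R,
      (forall n : nat,
         [/\ is_solution p lambda a b f (u n),
             forall k : int, 0 <= u n k &
             spaceX p a b (u n)]) /\
      normX p a b (u n) @[n --> \oo] --> +oo.
Proof.
move=> lambda l0.
have p0 : 0 < p by exact: lt_trans hp.
have [[b0 b00 bb0] _] := hi.
have [hcd hc hf0] := hiii.
have [r r0 hr] := hiv.
have d_gt0 n : 0 < d n.
  by have [c0 cd _] := hcd n; exact: lt_trans cd.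
have d_large (B : R) : exists n, B <= d n.
  have [n _ /(_ n (leqnn _)) Bn] := (cvgryPge _).1 hc B.
  by exists n; apply: le_trans Bn _; have [_ /ltW] := hcd n.
have cf k : continuous (fun t => f (k, t)).
  move=> t; have ck : (k, x) @[x --> t] --> (k, t).
    move=> A [[B C] /= [Bk Ct] BCA]; apply: filterS Ct => x Cx.
    by apply: BCA; split => //; exact: nbhs_singleton Bk.
  exact: (cvg_comp _ f ck (hf (k, t))).
(* By (ii), [|f (k, t)| < |t| ^ (p - 1)] for small nonzero [t]; continuity in [t] then forces the
   value 0. *)
have f0 k : f (k, 0) = 0.
  apply: contrapT => /eqP fk0; pose y := `|f (k, 0)| / 2.
  have y0 : 0 < y by rewrite divr_gt0 // normr_gt0.
  have p10 : 0 < p - 1 by rewrite subr_gt0.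
  have /cvgrPdist_lt pow_small := cvg_normr_powR0 _ p10.
  have /cvgrPdist_lt cfk := cf k 0.
  near (0 : R)^' => t.
  have t0 : 0 < `|t| `^ (p - 1).
    by rewrite powR_gt0 // normr_gt0; near: t; exact: nbhs_dnbhs_neq.
  have ft : `|f (k, t)| < `|t| `^ (p - 1).
    have : forall j, `| `|f (j, t)| / `|t| `^ (p - 1) - 0 | < 1.
      by near: t; exact: hii.
    move=> /(_ k); rewrite subr0 ger0_norm ?divr_ge0 ?powR_ge0 //.
    by rewrite ltr_pdivrMr // mul1r.
  have ty : `|0 - `|t| `^ (p - 1)| < y.
    by near: t; exact: pow_small.
  have cy : `|f (k, 0) - f (k, t)| < y.
    by near: t; apply: cvg_within; exact: cfk.
  have := ler_normD (f (k, 0) - f (k, t)) (f (k, t)); rewrite subrK.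
  rewrite sub0r normrN (@ger0_norm _ (_ `^ _)) ?powR_ge0 // in ty.
  have : `|f (k, 0)| = y + y by rewrite -splitr.
  lra.
pose mu := p * lambda.
have mu0 : 0 < mu by rewrite mulr_gt0.
pose sigma n k := ereal_sup [set `|primitive f k t|%:E | t in `[r, d n]].
have sigma_ge n k t : 0 <= t <= d n -> (`|primitive f k t|%:E <= sigma n k)%E.
  move=> /andP[t0 tn]; apply: ereal_sup_ubound; exists t => //=.
  by rewrite in_itv /= tn andbT; apply: le_trans t0; exact: ltW.
have sigma0 n k : (0 <= sigma n k)%E.
  by apply: le_trans (sigma_ge n k 0 _); rewrite ?lee_fin // lexx ltW.
have sigma_fin n k : sigma n k \is a fin_num.
  by rewrite ge0_fin_numE //; apply: le_lt_trans (hr n); exact: term_le_esum.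
(* This family plays two roles: [s n] shifts the densities on the large box, and [s m] is the
   threshold to be exceeded. *)
pose s n k := mu * fine (sigma n k).
have s0 n k : 0 <= s n k by apply: mulr_ge0; [exact: ltW|exact: fine_ge0].
have s_fin n : (\esum_(k in [set: int]) (s n k)%:E < +oo)%E.
  under eq_esum => k _ do rewrite EFinM fineK //.
  exact: (esum_scale_lty mu _ (ltW mu0) (sigma0 n) (hr n)).
have s_ge n k t : 0 <= t <= d n -> mu * primitive f k t <= s n k.
  move=> tn; rewrite ler_pM2l //; apply: le_trans (ler_norm _) _.
  by rewrite -lee_fin fineK //; exact: sigma_ge.
(* All that is retained from (v), (vi) or (vii) is one site and one height, at least 1, with a large
   ratio. *)
have growth (M : R) : exists k t, 1 <= t /\ M < growth_ratio p a b f k t.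
  have ge1 : pinfty_nbhs R [set t | 1 <= t] by exact: nbhs_pinfty_ge.
  have gez F : ProperFilter F -> limf_esup
      (fun x : int * R => (growth_ratio p a b f x.1 x.2)%:E) (filter_prod F (pinfty_nbhs R)) = +oo%E ->
      exists k t, 1 <= t /\ M < growth_ratio p a b f k t.
    move=> FF E; have : (M%:E < +oo)%E by rewrite ltry.
    rewrite -E => ME; pose V : set (int * R) := setT `*` [set t | 1 <= t].
    have FV : filter_prod F (pinfty_nbhs R) V.
      by exists (setT, [set t | 1 <= t]) => //=; split => //; exact: filterT.
    by have [[k t] [_ /= t1] Mt] := lt_limf_esup _ _ _ _ ME FV; exists k, t.
  case: hv_vi_vii => [|| E]; [exact: gez|exact: gez|].
  have : (M%:E < +oo)%E by rewrite ltry.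
  rewrite -E => /ereal_sup_gt[_ [k _ <-] Mk].
  have [t t1 Mt] := lt_limf_esup _ _ _ _ Mk ge1.
  by exists k, t.
suff unbounded (N : R) : exists u, [/\ is_solution p lambda a b f u,
    forall k : int, 0 <= u k & spaceX p a b u] /\ N <= normX p a b u.
  have /choice[u hu] := fun n : nat => unbounded n%:R.
  exists u; split => [n|]; first exact: (hu n).1.
  apply/cvgryPge => B.
  near=> n; apply: le_trans (hu n).2; near: n; exact: nbhs_infty_ger.
(* By [normX_ge], a coordinate of size at least [d m] will force a norm of at least [N]. *)
have [m dm] := d_large (N / b0 `^ p^-1).
pose Sm := fine (\esum_(k in [set: int]) (s m k)%:E)%E.
have SmE : (Sm%:E = \esum_(k in [set: int]) (s m k)%:E)%E.
  by rewrite fineK // ge0_fin_numE // esum_ge0 // => k _; rewrite lee_fin.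
(* With [A = (a (k + 1) + a k + b k) * t ^ p], this level gives [mu * F(k, t) > A + (Sm / b0) * A],
   which is at least [A + Sm] since [t >= 1] yields [A >= b0]. *)
have [k [t [t1 kt]]] := growth ((1 + Sm / b0) / mu).
have [n tn] := d_large t.
have prim_eq j : exists Hj : R -> R,
    (forall x, 0 <= x <= d n -> is_derive x 1 Hj (mu * f (j, x))) /\
    (forall x, 0 <= x <= d n -> Hj x = mu * primitive f j x).
  have [H [dH HE]] := antiderivative _ (d n) (cf j).
  exists (fun x => mu * (H x - H 0)); split => x xd.
    have dHx := dH x xd.
    apply: is_derive_eq; rewrite /GRing.scale /=; ring.
  by rewrite /primitive /oriented_integral ifT ?HE //; case/andP: xd.
have {prim_eq}/choice[H HP] := prim_eq.
have dH j x : 0 <= x <= d n -> is_derive x 1 (H j) (mu * f (j, x)) by exact: (HP j).1.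
have HE j x : 0 <= x <= d n -> H j x = mu * primitive f j x by exact: (HP j).2.
have H0 j : H j 0 = 0.
  rewrite HE ?lexx ?ltW // /primitive /oriented_integral lexx set_itv1.
  by rewrite Rintegral_set1 mulr0.
have Hs j x : 0 <= x <= d n -> H j x <= s n j by move=> xd; rewrite HE // s_ge.
have h0 j : mu * f (j, 0) = 0 by rewrite f0 mulr0.
have hD j : mu * f (j, d n) <= 0.
  by rewrite pmulr_rle0 //; apply: (hf0 _ n); rewrite lexx andbT ltW //; have [] := hcd n.
have [u bu umin] := exists_action_min p (d n) b0 a b (s n) _ H hp (d_gt0 n) b00 ha bb0 dH Hs.
have ufin : (action p a b (s n) H u < +oo)%E.
  apply: le_lt_trans (umin _ (box0 _ (d_gt0 n))) _.
  by rewrite (action0 p a b (s n) H hp H0).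
have uX : spaceX p a b u.
  apply: le_lt_trans ufin; apply: le_esum => j _; rewrite lee_fin.
  exact: (density_ge_elastic p (d n) a b (s n) H Hs u j bu).
exists u; split; first split => //.
- split.
    move=> j; have := action_min_critical p (d n) b0 a b (s n) _ H hp (d_gt0 n)
      b00 ha bb0 dH Hs h0 hD u j bu ufin umin.
    (* Cancelling the common factor [p] leaves the equation with parameter [lambda]. *)
    rewrite /mu -mulrA => /(mulfI _) <-; last by rewrite gt_eqF.
    by rewrite /fdiff !addrK ?subrK; ring.
  exact: (action_cvg0 p (d n) b0 a b (s n) H hp b00 ha bb0 Hs u bu ufin).
- by move=> j; case/andP: (bu j).
have [j sj] : exists j, s m j < H j (u j).
  have td : 0 <= t <= d n by rewrite tn (le_trans ler01).
  apply: (action_min_large p (d n) b0 a b (s n) H hp (d_gt0 n) b00 ha bb0 H0 Hs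
    (s_fin n) u k t) => //.
  rewrite -SmE lte_fin HE // ltrBrDr.
  set A := (_ + _) * _.
  have tp1 : 1 <= t `^ p.
    have <- : 1 `^ p = (1 : R) by rewrite powR1.
    apply: ge0_ler_powR; rewrite ?nnegrE ?ler01 //.
      exact: ltW.
    exact: le_trans t1.
  have A0 : b0 <= A.
    have aa : 0 <= a (k + 1) + a k by rewrite addr_ge0 ?ltW.
    rewrite -[leLHS]mulr1; apply: ler_pM; rewrite ?ler01 //; first exact: ltW.
    by rewrite (le_trans (bb0 k)) // lerDr.
  have Sm0 : 0 <= Sm / b0.
    by rewrite divr_ge0 ?(ltW b00) // fine_ge0 // esum_ge0 // => i _; rewrite lee_fin.
  move: kt; rewrite /growth_ratio -/A ltr_pdivlMr; last exact: lt_le_trans A0.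
  rewrite -(@ltr_pM2l _ mu) //; apply: le_lt_trans.
  have -> : mu * ((1 + Sm / b0) / mu * A) = Sm / b0 * A + A.
    by rewrite mulrA [mu * _]mulrC divfK ?gt_eqF // mulrDl mul1r addrC.
  rewrite lerD2r; apply: (@le_trans _ _ (Sm / b0 * b0)); last exact: ler_wpM2l.
  by rewrite divfK // gt_eqF.
(* Below [d m], the bound [s_ge] on the smaller box would give [H j (u j) <= s m j]. *)
have uj : d m <= u j.
  rewrite leNgt; apply: contraTN sj => ud; rewrite -leNgt HE // s_ge //.
  by case/andP: (bu j) => -> _; exact: ltW.
apply: le_trans (normX_ge p b0 (d m) a b u j hp b00 ha bb0 _ uX).
  by rewrite mulrC -ler_pdivrMr // powR_gt0.
by rewrite ltW //= (le_trans uj) // ler_norm.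
Unshelve. all: end_near. Qed.
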